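(* Let $r$ be a positive integer and let $w$ be a finite word over $\{0,1\}$. If $\widetilde w$ is the word obtained by reversing the order of the bits of $w$, then in $\mathbb{Z}[Y][[X]]$ $$R_{1,0}(w,r)=R_{0,1}(\widetilde w,r)\prod_{h=0}^{r-1}\frac1{1-XY^h}.$$
   Context: For $b,c\in\{0,1\}$ and a finite word $w$ over $\{0,1\}$, extend $w$ to a doubly infinite bit sequence $s:\mathbb{Z}\to\{0,1\}$ by adding infinitely many bits $b$ on its left and infinitely many bits $c$ on its right. A placement of $n$ $r$-ribbons (below the lattice path described by $s$: a unit step right for each bit $0$ and up for each bit $1$, read from left to right) is a sequence of positions $i_1<i_2<\cdots<i_n$ in $\mathbb{Z}$ such that one can successively, for $t=1,2,\dots,n$, perform the following change: the current bit sequence $s^{(t-1)}$ (with $s^{(0)}=s$) satisfies $s^{(t-1)}_{i_t-r}=1$ and $s^{(t-1)}_{i_t}=0$, and $s^{(t)}$ is obtained from it by setting the bit at $i_t-r$ to $0$ and the bit at $i_t$ to $1$. The height of the $t$-th ribbon is $\sum_{j=1}^{r-1}s^{(t-1)}_{i_t-j}$, and the total height of the placement is the sum of the heights of its $n$ ribbons. Then $$R_{b,c}(w,r)=\sum X^nY^{h},$$ the sum being over all placements of $r$-ribbons (all $n\ge0$, including the empty placement), where $n$ is the number of ribbons and $h$ the total height of the placement. (For each $n$ there are finitely many placements, so this is an element of $\mathbb{Z}[Y][[X]]$; for $(b,c)=(0,1)$ it is a polynomial.) *)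

(* Defs.v *)
From HB Require Import structures.
From mathcomp Require Import all_boot all_order all_algebra.
From mathcomp Require Import boolp classical_sets functions cardinality fsbigop.
From mathcomp Require Import zify.

Set Implicit Arguments.
Unset Strict Implicit.
Unset Printing Implicit Defensive.

Import Order.TTheory GRing.Theory Num.Theory.
Local Open Scope ring_scope.

(* {fps R}: the formal power series ring R[[X]]. A series is wrapped in a
   record because a bare function nat -> R already carries the pointwise
   product. *)
Record fpseries (R : Type) := FPS { fpscoef : nat -> R }.

Notation "{ 'fps' R }" := (fpseries R) (at level 0, format "{ 'fps'  R }")
  : type_scope.

HB.instance Definition _ (R : Type) := gen_eqMixin {fps R}.
HB.instance Definition _ (R : Type) := gen_choiceMixin {fps R}.

Lemma fpsP (R : Type) (f g : {fps R}) : fpscoef f =1 fpscoef g <-> f = g.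
Proof.
split=> [|->//]; case: f => f; case: g => g /= fg.
by congr FPS; apply/funext.
Qed.

Section FpsRing.
Variable R : comNzRingType.
Implicit Types f g h : {fps R}.

Definition fps0 : {fps R} := FPS (fun=> 0).
Definition fps_opp f : {fps R} := FPS (fun n => - fpscoef f n).
Definition fps_add f g : {fps R} := FPS (fun n => fpscoef f n + fpscoef g n).
Definition fps1 : {fps R} := FPS (fun n => (n == 0%N)%:R).
Definition fps_mul f g : {fps R} :=
  FPS (fun n => \sum_(i < n.+1) fpscoef f i * fpscoef g (n - i)%N).

Fact fps_addA : associative fps_add.
Proof. by move=> f g h; apply/fpsP => n /=; rewrite addrA. Qed.
Fact fps_addC : commutative fps_add.
Proof. by move=> f g; apply/fpsP => n /=; rewrite addrC. Qed.
Fact fps_add0 : left_id fps0 fps_add.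
Proof. by move=> f; apply/fpsP => n /=; rewrite add0r. Qed.
Fact fps_addN : left_inverse fps0 fps_opp fps_add.
Proof. by move=> f; apply/fpsP => n /=; rewrite addNr. Qed.

HB.instance Definition _ :=
  GRing.isZmodule.Build {fps R} fps_addA fps_addC fps_add0 fps_addN.

Definition fps_trunc N f : {poly R} := \poly_(i < N) fpscoef f i.

Lemma coef_fps_mul N f g n : (n < N)%N ->
  fpscoef (fps_mul f g) n = (fps_trunc N f * fps_trunc N g)`_n.
Proof.
move=> nN; rewrite coefM; apply: eq_bigr => i _; rewrite !coef_poly.
by rewrite (leq_trans (ltn_ord i) nN) (leq_ltn_trans (leq_subr i n) nN).
Qed.

Fact fps_mulC : commutative fps_mul.
Proof.
by move=> f g; apply/fpsP => n; rewrite !(@coef_fps_mul n.+1)// mulrC.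
Qed.

Fact fps_mulA : associative fps_mul.
Proof.
move=> f g h; apply/fpsP => n.
have trM u v (i : 'I_n.+1) : (fps_trunc n.+1 (fps_mul u v))`_i
    = (fps_trunc n.+1 u * fps_trunc n.+1 v)`_i.
  by rewrite coef_poly ltn_ord (@coef_fps_mul n.+1).
rewrite !(@coef_fps_mul n.+1)//.
transitivity
  ((fps_trunc n.+1 f * (fps_trunc n.+1 g * fps_trunc n.+1 h))`_n).
  rewrite !coefM; apply: eq_bigr => i _; congr (_ * _).
  have lt : (n - i < n.+1)%N by rewrite ltnS leq_subr.
  by rewrite (trM g h (Ordinal lt)).
by rewrite mulrA !coefM; apply: eq_bigr => i _; rewrite trM.
Qed.

Fact fps_mul1 : left_id fps1 fps_mul.
Proof.
move=> f; apply/fpsP => n /=.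
rewrite big_ord_recl /= mul1r subn0 big1 ?addr0// => i _.
by rewrite /bump /= mul0r.
Qed.

Fact fps_mulDl : left_distributive fps_mul fps_add.
Proof.
move=> f g h; apply/fpsP => n /=; rewrite -big_split /=.
by apply: eq_bigr => i _; rewrite mulrDl.
Qed.

Fact fps1_neq0 : fps1 != fps0.
Proof.
apply/eqP => /fpsP /(_ 0%N) /= /eqP; exact/negP/oner_neq0.
Qed.

HB.instance Definition _ := GRing.Zmodule_isComNzRing.Build {fps R}
  fps_mulA fps_mulC fps_mul1 fps_mulDl fps1_neq0.

Definition fpsX : {fps R} := FPS (fun n => (n == 1%N)%:R).
Definition fpsC (c : R) : {fps R} := FPS (fun n => if n == 0%N then c else 0).

End FpsRing.

Arguments fpsX {R}.

Section FpsUnitRing.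
Variable R : comUnitRingType.
Implicit Types f g : {fps R}.

Definition fps_unit : {pred {fps R}} :=
  [pred f | fpscoef f 0%N \is a GRing.unit].

(* The first n coefficients of the inverse of f, obtained by solving
   f * g = 1 for one coefficient after the other. *)
Fixpoint fps_inv_seq f n : seq R :=
  if n is m.+1 then
    let s := fps_inv_seq f m in
    rcons s (if m == 0%N then (fpscoef f 0%N)^-1 else
      - (fpscoef f 0%N)^-1 *
        \sum_(i < m) fpscoef f i.+1 * s`_(m.-1 - i))
  else [::].

Definition fps_inv f : {fps R} :=
  if f \in fps_unit then FPS (fun n => (fps_inv_seq f n.+1)`_n) else f.

Lemma size_fps_inv_seq f n : size (fps_inv_seq f n) = n.
Proof. by elim: n => //= n IHn; rewrite size_rcons IHn. Qed.

Lemma nth_fps_inv_seq f n i : (i < n)%N ->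
  (fps_inv_seq f n)`_i = (fps_inv_seq f i.+1)`_i.
Proof.
elim: n => // n IHn; rewrite ltnS leq_eqVlt => /orP[/eqP->//|lt_in].
by rewrite -IHn//= nth_rcons size_fps_inv_seq lt_in.
Qed.

Fact fps_mulVx : {in fps_unit, left_inverse 1 fps_inv *%R}.
Proof.
move=> f fU; rewrite mulrC /fps_inv fU; apply/fpsP => n.
have f0U : fpscoef f 0%N \is a GRing.unit by [].
rewrite [LHS]/= big_ord_recl /= nth_rcons size_fps_inv_seq subn0 ltnn eqxx.
case: n => [|n] /=; first by rewrite big_ord0 addr0 divrr.
rewrite mulrA mulrN divrr// mulN1r; apply/eqP; rewrite addrC subr_eq0.
apply/eqP/eq_bigr => i _; congr (_ * _).
have -> : (n.+1 - bump 0 i = n - i)%N by rewrite /bump /=; lia.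
have lt : (n - i < n.+1)%N by rewrite ltnS leq_subr.
exact: esym (nth_fps_inv_seq f lt).
Qed.

Fact fps_unitPl f g : g * f = 1 -> fps_unit f.
Proof.
move=> /fpsP/(_ 0%N) /=; rewrite big_ord1 /= => gf1.
by apply/unitrPr; exists (fpscoef g 0%N); rewrite mulrC.
Qed.

Fact fps_inv_out : {in [predC fps_unit], fps_inv =1 id}.
Proof. by move=> f /negbTE fU; rewrite /fps_inv fU. Qed.

HB.instance Definition _ := GRing.ComNzRing_hasMulInverse.Build {fps R}
  fps_mulVx fps_unitPl fps_inv_out.

Lemma fps_unitE f :
  (f \is a GRing.unit) = (fpscoef f 0%N \is a GRing.unit).
Proof. by []. Qed.

Lemma fps_unit_1BXC c : (1 - fpsX * fpsC c : {fps R}) \is a GRing.unit.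
Proof. by rewrite fps_unitE /= big_ord1 /= mul0r subr0 unitr1. Qed.

End FpsUnitRing.

(* The bit 1 is true and the bit 0 is false. The first letter of w sits at
   position 0; moving this origin only translates the placements. *)
Definition extend_word (b c : bool) (w : seq bool) (i : int) : bool :=
  match i with Posz k => nth c w k | Negz _ => b end.

Definition can_add_ribbon (r : nat) (s : int -> bool) (i : int) : bool :=
  s (i - r%:Z) && ~~ s i.

Definition add_ribbon (r : nat) (s : int -> bool) (i : int) : int -> bool :=
  fun j => if j == i - r%:Z then false else if j == i then true else s j.

Definition ribbon_height (r : nat) (s : int -> bool) (i : int) : nat :=
  (\sum_(1 <= j < r) s (i - j%:Z)%R)%N.

Fixpoint can_add_ribbons (r : nat) (s : int -> bool) (p : seq int) : bool :=
  if p is i :: p' then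
    can_add_ribbon r s i && can_add_ribbons r (add_ribbon r s i) p'
  else true.

Fixpoint total_height (r : nat) (s : int -> bool) (p : seq int) : nat :=
  if p is i :: p' then
    (ribbon_height r s i + total_height r (add_ribbon r s i) p')%N
  else 0%N.

Definition placements (r : nat) (s : int -> bool) (n : nat) : set (seq int) :=
  [set p : seq int |
    [&& size p == n, sorted <%R p & can_add_ribbons r s p]]%classic.

(* R_{b,c}(w, r), as a power series in X whose coefficients are polynomials in
   Y, the variable 'X of {poly int}. The sum over the set of placements is a
   finitely supported one: it would be 0 if this set were infinite, which
   finite_placements below excludes. *)
Definition ribbon_series (b c : bool) (w : seq bool) (r : nat)
  : {fps {poly int}} :=
  FPS (fun n =>
    \sum_(p \in placements r (extend_word b c w) n)
      ('X^(total_height r (extend_word b c w) p) : {poly int})).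

Lemma can_add_ribbons_bounded r s b c N p :
  (forall i : int, i < - N%:Z -> s i = b) ->
  (forall i : int, N%:Z <= i -> s i = c) ->
  can_add_ribbons r s p ->
  all (fun i : int => `|i| <= (N + size p * r)%N%:Z) p.
Proof.
elim: p s N => //= i p IHp s N sb sc /andP[/andP[si1 si0] sp].
have iN1 : - N%:Z <= i.
  rewrite leNgt; apply/negP => iN; move: si1 si0.
  by rewrite !sb; [case: (b) | lia | lia].
have iN2 : i < (N + r)%N%:Z.
  rewrite ltNge; apply/negP => iN; move: si1 si0.
  by rewrite !sc; [case: (c) | lia | lia].
apply/andP; split; first by rewrite mulSn; lia.
rewrite mulSn addnA; apply: IHp sp => j jN; rewrite /add_ribbon !ifF;
  by [apply: sb; lia | apply: sc; lia | apply/eqP; lia].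
Qed.

Lemma finite_placements b c w r n :
  finite_set (placements r (extend_word b c w) n).
Proof.
pose M := (size w + n * r)%N.
pose f (t : n.-tuple 'I_(M + M).+1) : seq int :=
  [seq (val j)%:Z - M%:Z | j <- t].
apply: (@sub_finite_set _ _ (range f)); last exact/finite_image/finite_finset.
move=> p /and3P[/eqP sz _ pP].
have {pP} pM : all (fun i : int => `|i| <= M%:Z) p.
  rewrite /M -sz; apply: (@can_add_ribbons_bounded _ _ b c _ _ _ _ pP) => [[i|i]|[i|i]] //=.
  - by move=> ?; exfalso; lia.
  - by rewrite lez_nat => /(nth_default c).
pose g (i : int) : 'I_(M + M).+1 := inord (absz (i + M%:Z)).
have gP : size [seq g i | i <- p] == n by rewrite size_map sz.
exists (Tuple gP) => //; rewrite /f /= -map_comp -[RHS]map_id.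
apply/eq_in_map => i /(allP pM) iM /=.
by rewrite inordK; lia.
Qed.

(* Main.v *)
(* Scan the bit sequence from left to right, remembering the window of the r
   bits that precede the current position. Reading a bit c appends c to the
   window and drops its first bit, or, if that first bit is 1 and c = 0, places
   a ribbon: 1 is appended instead, with weight X Y^h for h the number of ones
   among the remaining r - 1 bits. Write T_w for the resulting operator on
   formal combinations of windows. As T_1 preserves the sum of coefficients
   and T_0 fixes 0^r,
     R_{0,1}(w) = sum of the coefficients of T_w 0^r,
     R_{1,0}(w) = lim_k of the same sum for T_0^k T_w 1^r.
   There is a bilinear form B ([glue]) with B(T_c u, v) = B(u, T_c v),
   B(u, 1^r) = 1 and B(0^r, 0^r) = prod_h (1 - X Y^h). Under T_0^k a window
   tends X-adically to a multiple of 0^r, so that in the limit the sum of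
   coefficients may be replaced with B(0^r, -) / B(0^r, 0^r); then
   B(0^r, T_w 1^r) = B(T_{rev w} 0^r, 1^r) = R_{0,1}(rev w). *)
Require Import Defs.
From mathcomp Require Import all_boot all_order all_algebra.
From mathcomp Require Import classical_sets fsbigop.
From mathcomp Require Import zify ring.
Import Order.TTheory GRing.Theory Num.Theory.
Local Open Scope ring_scope.

Set Implicit Arguments.
Unset Strict Implicit.

(** * Transfer operators on windows and their adjointness *)

Section Transfer.
Variable R : comNzRingType.
Implicit Types (f g : seq bool -> R) (u v w : seq bool) (x y : R).

Definition shift u c := rcons (behead u) c.

(** Dual form of the operators: [f] is a functional on windows, evaluated at the image of [u] under
    the operator of [w], so that no formal combinations are needed. *)
Fixpoint transfer x y f w u : R :=
  if w is c :: w' then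
    transfer x y f w' (shift u c) +
    (if head false u && ~~ c
     then x * y ^+ count id (behead u) * transfer x y f w' (shift u true)
     else 0)
  else f u.

Lemma size_shift u c r : size u = r.+1 -> size (shift u c) = r.+1.
Proof. by case: u => //= a u [<-]; rewrite size_rcons. Qed.

Lemma transfer_cat x y f w1 w2 u :
  transfer x y f (w1 ++ w2) u = transfer x y (transfer x y f w2) w1 u.
Proof. by elim: w1 u => //= c w1 IH u; rewrite !IH. Qed.

Lemma eq_transfer x y r f g w u : size u = r.+1 ->
  (forall v, size v = r.+1 -> f v = g v) ->
  transfer x y f w u = transfer x y g w u.
Proof.
move=> su fg; elim: w u su => /= [|c w IH] u su; first exact: fg.
by rewrite !IH //; apply: size_shift.
Qed.

Lemma transfer_linear x y a f g w u :
  transfer x y (fun v => a * f v + g v) w u =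
  a * transfer x y f w u + transfer x y g w u.
Proof.
elim: w u => //= c w IH u; rewrite !IH.
by case: ifP => _; ring.
Qed.

Lemma transfer_const_true x y k u : transfer x y (fun=> 1) (nseq k true) u = 1.
Proof. by elim: k u => //= k IH u; rewrite andbF addr0 IH. Qed.

Lemma shift_false r : shift (nseq r.+1 false) false = nseq r.+1 false.
Proof. by rewrite /shift /=; elim: r => //= r ->. Qed.

Lemma transfer_zero x y f k r :
  transfer x y f (nseq k false) (nseq r.+1 false) = f (nseq r.+1 false).
Proof. by elim: k => //= k IH; rewrite addr0 -[false :: _]/(nseq r.+1 false) shift_false. Qed.

(* Each block of [r] steps through the bit 0 either clears the window or moves
   a ribbon, which costs a factor [x]. *)
Lemma transfer_tail x y f r : f (nseq r.+1 false) = 0 ->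
  forall n k u, size u = r.+1 -> (n * r.+1 <= k)%N ->
  exists h, transfer x y f (nseq k false) u = x ^+ n * h.
Proof.
move=> f0; elim=> [|n IHn] k u su nk.
  by eexists; rewrite expr0 mul1r.
(* [j] counts the bits still to be dropped before the window is all zero. *)
suff inner j : forall k v, size v = j -> (j <= r.+1)%N -> (n * r.+1 + j <= k)%N ->
    exists h, transfer x y f (nseq k false) (v ++ nseq (r.+1 - j) false)
              = x ^+ n.+1 * h.
  have := inner r.+1 k u su (leqnn _).
  by rewrite subnn cats0; apply; rewrite addnC -mulSn.
elim: j {k nk u su} => [|j IHj] k v.
  by move/size0nil=> -> _ _; exists 0; rewrite subn0 transfer_zero f0 mulr0.
case: v => // a v [sv] jr; case: k => [|k]; first by rewrite addnS.
rewrite addnS ltnS => nk.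
have [g1 E1] := IHj k v sv (ltnW jr) nk.
have shiftE b : shift ((a :: v) ++ nseq (r.+1 - j.+1) false) b
    = v ++ rcons (nseq (r.+1 - j.+1) false) b by rewrite /shift /= rcons_cat.
(* The ribbon gives one factor [x]; the window is arbitrary again, and the outer induction gives the
   other [n]. *)
have [g2 E2] : exists h, transfer x y f (nseq k false)
    (shift ((a :: v) ++ nseq (r.+1 - j.+1) false) true) = x ^+ n * h.
  apply: IHn; last exact: leq_trans (leq_addr _ _) nk.
  by rewrite shiftE size_cat size_rcons size_nseq sv -subSn // subSS subnKC // ltnW.
rewrite /= in E2 *.
exists (g1 + (if a then y ^+ count id (v ++ nseq (r.+1 - j.+1) false) * g2 else 0)).
rewrite E2 -cat_cons shiftE.
have -> : rcons (nseq (r.+1 - j.+1) false) false = nseq (r.+1 - j) false.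
  by rewrite -cats1 -(nseqD _ 1) subSS subSn // addn1.
by rewrite E1 andbT exprS; case: (a); ring.
Qed.

(** Carries the divisibility gained on the final zeros back over the letters read before them. *)
Lemma transfer_dvd x y a f r w u :
  (forall v, size v = r.+1 -> exists h, f v = a * h) -> size u = r.+1 ->
  exists h, transfer x y f w u = a * h.
Proof.
move=> af; elim: w u => [|c w IH] u su /=; first exact: af.
have [h1 ->] := IH _ (size_shift c su).
have [h2 ->] := IH _ (size_shift true su).
exists (h1 + (if head false u && ~~ c then x * y ^+ count id (behead u) * h2 else 0)).
by case: ifP => _; ring.
Qed.

(* For y = 1 this is the r-th tensor power of the form on {0,1} with value
   1 - x at (0, 0) and 1 elsewhere, with r the common size of [u] and [v]. In
   general the recursion is forced by [transfer_adjoint]: a pair of facing bits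
   can be removed at either end, see [glue_rcons]. Facing bits of two windows
   have opposite indices, whence the [rev] in [transfer_adjoint]. *)
Fixpoint glue y x u v : R :=
  match u, v with
  | a :: u', b :: v' =>
    if a then glue y (x * y) u' v' else
    (1 - x * y ^+ size u') * glue y x u' v' +
    (if b then x * y ^+ count id v' * glue y (x * y) u' v' else 0)
  | _, _ => 1
  end.

(** The recursion of [glue] read from the other end, where the two windows exchange roles. *)
Lemma glue_rcons y x u v a b : size u = size v ->
  glue y x (rcons u a) (rcons v b) =
  if b then glue y (x * y) u v else
    (1 - x * y ^+ size u) * glue y x u v +
    (if a then x * y ^+ count id u * glue y (x * y) u v else 0).
Proof.
elim: u v x => [|a0 u IH] [|b0 v] x //=.
  by move=> _; case: a; case: b; rewrite /= ?expr0; ring.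
case=> suv; rewrite !IH // size_rcons -cats1 count_cat /= addn0 exprD !exprS.
by case: a0; case: b0; case: (a); case: (b); rewrite /= ?exprS ?expr0 ?expr1; ring.
Qed.

Lemma glue_zero y x r : glue y x (nseq r false) (nseq r false) =
  \prod_(h < r) (1 - x * y ^+ h).
Proof.
elim: r => [|r IH] /=; first by rewrite big_ord0.
by rewrite size_nseq IH addr0 big_ord_recr /= mulrC.
Qed.

Lemma glue_ones y x u : glue y x u (nseq (size u) true) = 1.
Proof.
elim: u x => //= a u IH x; rewrite !IH count_nseq mul1n.
by case: a => //; ring.
Qed.

(** Appending [c] to a window puts it first in [rev u] but last in [v]; peeling the pair at that end
    leaves the same two windows of length [r] on both sides. *)
Lemma transfer_adjoint1 x y r u v c : size u = r.+1 -> size v = r.+1 ->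
  transfer x y (fun u' => glue y x (rev u') v) [:: c] u =
  transfer x y (glue y x (rev u)) [:: c] v.
Proof.
case: u v => // a u [|b v] //= [su] [sv].
rewrite /shift /= !rev_cons !rev_rcons /= !glue_rcons ?size_rev ?su ?sv //.
rewrite [count id (rev u)]count_rev.
by case: a; case: b; case: c; rewrite /= ?addr0; ring.
Qed.

Lemma transfer_adjoint x y r w u v : size u = r.+1 -> size v = r.+1 ->
  transfer x y (glue y x (rev u)) w v =
  transfer x y (fun u' => glue y x (rev u') v) (rev w) u.
Proof.
move=> su; elim: w v => // c w IH v sv.
rewrite rev_cons -cats1 transfer_cat.
(* The last letter of [rev w] crosses the form first; the rest follows by linearity in the
   functional. *)
transitivity (transfer x y (fun u' => transfer x y (glue y x (rev u')) [:: c] v)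
    (rev w) u); last first.
  by apply: eq_transfer su _ => u' su'; rewrite (transfer_adjoint1 x y c su' sv).
rewrite /= !IH ?(size_shift _ sv) //.
case: ifP => _; last by rewrite addr0; apply: eq_transfer su _ => u' _; rewrite addr0.
rewrite addrC -transfer_linear.
by apply: eq_transfer su _ => u' _; rewrite addrC.
Qed.

End Transfer.

(** * Coefficients of power series *)

Section Series.
Variable R : comNzRingType.

Lemma coef_fpsM (f g : {fps R}) n :
  fpscoef (f * g) n = \sum_(i < n.+1) fpscoef f i * fpscoef g (n - i)%N.
Proof. by []. Qed.

Lemma coef_fpsXCM (c : R) (f : {fps R}) n :
  fpscoef (fpsX * fpsC c * f) n = if n is m.+1 then c * fpscoef f m else 0.
Proof.
have XCE i : fpscoef (fpsX * fpsC c) i = if i == 1%N then c else 0.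
  case: i => [|i] /=; first by rewrite big_ord1 /= mul0r.
  rewrite big_ord_recl /= mul0r add0r big_ord_recl /= mul1r big1 ?addr0 ?subn1 //.
  by move=> j _; rewrite /= mul0r.
case: n => [|n]; first by rewrite coef_fpsM big_ord1 XCE mul0r.
rewrite coef_fpsM big_ord_recl XCE mul0r add0r big_ord_recl XCE big1.
  by rewrite addr0 /= subn1.
by move=> j _; rewrite XCE mul0r.
Qed.

Lemma coef_fpsXnM n m (f : {fps R}) :
  (m < n)%N -> fpscoef (fpsX ^+ n * f) m = 0.
Proof.
have X1 : fpsX = fpsX * fpsC (1 : R).
  apply/fpsP => i; rewrite -[RHS]/(fpscoef (fpsX * fpsC 1) i).
  have := coef_fpsXCM 1 1 i; rewrite mulr1 => ->.
  by case: i => [|i] //=; rewrite mul1r.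
elim: n m => // n IH m; rewrite exprS -mulrA X1 coef_fpsXCM -X1.
by case: m => // m mn; rewrite IH ?mulr0.
Qed.

Lemma fpsC_exp (c : R) n : fpsC (c ^+ n) = fpsC c ^+ n.
Proof.
elim: n => [|n IH]; first by apply/fpsP => -[].
rewrite !exprS -IH; apply/fpsP => m /=.
rewrite big_ord_recl /= subn0 big1 ?addr0; last by move=> i _; rewrite mul0r.
by case: m => [|m] //=; rewrite mulr0.
Qed.

End Series.

(** * Placements enumerated by a scan *)

Section Scan.
Variable r : nat.
Implicit Types (s : int -> bool) (i : int) (p : seq int).

(** Decides position by position, to match the recursion of [transfer]. *)
Fixpoint scan s i K n : seq (seq int) :=
  if K is K'.+1 then
    scan s (i + 1) K' n ++
    (if n is m.+1 then
       if can_add_ribbon r.+1 s i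
       then [seq i :: p | p <- scan (add_ribbon r.+1 s i) (i + 1) K' m] else [::]
     else [::])
  else if n is 0%N then [:: [::]] else [::].

Lemma mem_scan s i K n p : (p \in scan s i K n) =
  [&& size p == n, sorted <%R p, can_add_ribbons r.+1 s p
    & all (fun j : int => (i <= j) && (j < i + K%:Z)) p].
Proof.
elim: K s i n p => [|K IH] s i n p.
  case: p => [|j p]; first by case: n.
  have -> : (j :: p \in scan s i 0 n) = false by case: n.
  apply/esym/negbTE/negP => /and4P[_ _ _ /= /andP[]]; lia.
rewrite /= mem_cat IH.
have E1 q : all (fun j : int => (i + 1 <= j) && (j < i + 1 + K%:Z)) q =
   (i \notin q) && all (fun j : int => (i <= j) && (j < i + K.+1%:Z)) q.
  elim: q => //= j q ->; rewrite inE negb_or.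
  by case: (i \notin q); case: all; rewrite ?andbF ?andbT //; lia.
have lt_path k q : path <%R k q = sorted <%R q && all (fun l => k < l) q.
  by rewrite (path_sortedE lt_trans) andbC.
case: n => [|n]; first by rewrite in_nil orbF; case: p => //.
case: p => [|j p].
  rewrite /=; case: ifP => // _; apply/mapP => -[] //.
case: (eqVneq i j) => [<-|ij].
  rewrite E1 mem_head !andbF /= eqSS lexx lt_path.
  have -> : i < i + K.+1%:Z by lia.
  case: ifP => ca; last by rewrite in_nil !andbF.
  rewrite mem_map ?IH; last by move=> ? ? [].
  have -> : all (fun j => (i + 1 <= j) && (j < i + 1 + K%:Z)) p =
     all (fun j => i < j) p && all (fun j => (i <= j) && (j < i + K.+1%:Z)) p.
    by rewrite -all_predI; apply: eq_all => k /=; lia.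
  by case: (size p == n); case: sorted; case: can_add_ribbons; case: all.
have -> : (j :: p \in (if can_add_ribbon r.+1 s i then
   [seq i :: p0 | p0 <- scan (add_ribbon r.+1 s i) (i + 1) K n] else [::])) = false.
  by case: ifP => // _; apply/negbTE/mapP => -[q _ [ji _]]; rewrite ji eqxx in ij.
rewrite orbF E1 inE (negbTE ij).
(* A later member equal to [i] would put the head [j] to the left of the range. *)
case: (boolP (i \in p)) => [ip|_] //; rewrite /= !andbF lt_path.
apply/esym/negbTE/negP => /and4P[_ /andP[_ /allP/(_ _ ip) ji] _ /andP[/andP[ij' _] _]].
lia.
Qed.

Lemma scan_uniq s i K n : uniq (scan s i K n).
Proof.
elim: K s i n => [|K IH] s i n /=; first by case: n.
rewrite cat_uniq IH /=; case: n => [|n] //=.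
case: ifP => // _; rewrite map_inj_uniq ?IH ?andbT; last by move=> ? ? [].
apply/hasP => -[q /mapP[p _ ->]]; rewrite mem_scan => /and4P[_ _ _ /= /andP[]].
lia.
Qed.

Definition scan_series s i K : {fps {poly int}} :=
  FPS (fun n => \sum_(p <- scan s i K n) 'X^(total_height r.+1 s p)).

Lemma scan_seriesS s i K : scan_series s i K.+1 = scan_series s (i + 1) K +
  (if can_add_ribbon r.+1 s i then
    fpsX * fpsC ('X^(ribbon_height r.+1 s i)) *
    scan_series (add_ribbon r.+1 s i) (i + 1) K else 0).
Proof.
apply/fpsP => n; rewrite -[RHS]/(fpscoef _ n + fpscoef _ n) [LHS]/= big_cat /=.
congr (_ + _); case: ifP => [ca|_]; last by case: n => [|n]; rewrite big_nil.
rewrite coef_fpsXCM; case: n => [|n]; first by rewrite big_nil.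
rewrite big_map /= mulr_sumr; apply: eq_bigr => p _.
by rewrite exprD.
Qed.

Definition bits s i K := [seq s (i + j%:Z) | j <- iota 0 K].
Definition window s i := bits s (i - r.+1%:Z) r.+1.

Lemma bitsS s i K : bits s i K.+1 = s i :: bits s (i + 1) K.
Proof.
rewrite /bits /= addr0 (iotaDl 1 0) -map_comp; congr (_ :: _).
by apply: eq_map => j /=; rewrite -addrA.
Qed.

Lemma bits_cat s i K L : bits s i (K + L) = bits s i K ++ bits s (i + K%:Z) L.
Proof.
elim: K i => [|K IH] i; first by rewrite addr0.
by rewrite addSn !bitsS IH; congr (_ :: _ ++ bits _ _ _); lia.
Qed.

Lemma eq_bits s t i j K : (forall k, (k < K)%N -> s (i + k%:Z) = t (j + k%:Z)) ->
  bits s i K = bits t j K.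
Proof. by move=> st; apply/eq_in_map => k; rewrite mem_iota => /st. Qed.

Lemma bits_nseq s i K b : (forall k, (k < K)%N -> s (i + k%:Z) = b) ->
  bits s i K = nseq K b.
Proof.
elim: K i => //= K IH i sb; rewrite bitsS IH => [|k kK].
  by rewrite -[i]addr0 sb.
by rewrite -addrA; apply: (sb k.+1).
Qed.

Lemma window_shift s i : window s (i + 1) = shift (window s i) (s i).
Proof.
rewrite /shift /window [in RHS]bitsS [behead _]/=.
have -> : i + 1 - r.+1%:Z = i - r%:Z by lia.
have -> : i - r.+1%:Z + 1 = i - r%:Z by lia.
by rewrite -cats1 -[in LHS]addn1 bits_cat bitsS subrK.
Qed.

(** The bit cleared by the ribbon is the one that drops out of the window. *)
Lemma window_add s i :
  window (add_ribbon r.+1 s i) (i + 1) = shift (window s i) true.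
Proof.
rewrite window_shift /shift /window !bitsS /=.
congr rcons; last by rewrite /add_ribbon eqxx; case: ifP => // /eqP; lia.
apply: eq_bits => k kr; rewrite /add_ribbon.
by case: eqP => [|_]; [lia|case: eqP => [|_]; [lia|]].
Qed.

Lemma ribbon_height_window s i :
  ribbon_height r.+1 s i = count id (behead (window s i)).
Proof.
rewrite /window bitsS /= /ribbon_height /bits count_map big_add1 /=.
rewrite big_nat_rev /= -sum1_count [RHS]big_mkcond /= /index_iota subn0.
apply: eq_big_seq => k; rewrite mem_iota => /andP[_ kr].
have -> : i - (0 + r - k.+1).+1%:Z = i - r.+1%:Z + 1 + k%:Z by lia.
by case: (s _).
Qed.

(** A ribbon at [i] changes nothing to the right of [i], so the scan reads the original bits and the
    window alone records earlier ribbons. *)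
Lemma scan_series_transfer s i K : scan_series s i K =
  transfer (R := {fps {poly int}}) fpsX (fpsC 'X) (fun=> 1) (bits s i K) (window s i).
Proof.
elim: K s i => [|K IH] s i.
  by apply/fpsP => -[|n] /=; rewrite ?big_nil // big_seq1 expr0.
rewrite scan_seriesS !IH window_shift window_add bitsS.
have -> : bits (add_ribbon r.+1 s i) (i + 1) K = bits s (i + 1) K.
  apply: eq_bits => k _; rewrite /add_ribbon.
  by case: eqP => [|_]; [lia|case: eqP => [|_]; [lia|]].
have hw : head false (window s i) = s (i - r.+1%:Z) by rewrite /window bitsS.
by rewrite /can_add_ribbon ribbon_height_window fpsC_exp -hw.
Qed.

End Scan.

(** * Ribbon series as transfers, and the identity *)

Lemma coef_ribbon_series b c w r n M : (size w + n * r.+1 <= M)%N ->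
  fpscoef (ribbon_series b c w r.+1) n =
  fpscoef (transfer (R := {fps {poly int}}) fpsX (fpsC 'X) (fun=> 1)
    (nseq M b ++ w ++ nseq (M - size w).+1 c) (nseq r.+1 b)) n.
Proof.
move=> wM; set s := extend_word b c w.
have sneg i : i < 0 -> s i = b by case: i.
have spos i : (size w)%:Z <= i -> s i = c.
  by case: i => [i|//]; rewrite lez_nat => /(nth_default c).
have -> : nseq r.+1 b = window r s (- M%:Z).
  by rewrite /window (bits_nseq (b := b)) // => k kr; apply: sneg; lia.
(* This is the stretch from [-M] to [M], both ends included; it contains the positions of all
   placements of [n] ribbons. *)
have -> : nseq M b ++ w ++ nseq (M - size w).+1 c = bits s (- M%:Z) (M + (size w + (M - size w).+1)).
  rewrite !bits_cat (bits_nseq (b := b)); last by move=> k kM; apply: sneg; lia.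
  rewrite (bits_nseq (b := c) (K := (M - size w).+1)); last by move=> k kM; apply: spos; lia.
  congr (_ ++ (_ ++ _)); rewrite addNr /bits.
  by rewrite -[LHS](mkseq_nth c); apply: eq_map => j; rewrite add0r.
rewrite -scan_series_transfer /= -/s [RHS]fsbig_seq ?scan_uniq //.
apply: eq_fsbigl; apply/seteqP; split=> p; rewrite /placements /= mem_scan.
  move=> /and3P[sp sr ca]; apply/and4P; split=> //.
  have /allP pM : all (fun i : int => `|i| <= (size w + size p * r.+1)%N%:Z) p.
    apply: (@can_add_ribbons_bounded _ s b c) ca => i iw; [apply: sneg|apply: spos]; lia.
  apply/allP => j /pM; rewrite (eqP sp); lia.
by case/and4P => sp sr ca _; apply/and3P.
Qed.

Lemma ribbon_series_false_true w r : ribbon_series false true w r.+1 =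
  transfer (R := {fps {poly int}}) fpsX (fpsC 'X) (fun=> 1) w (nseq r.+1 false).
Proof.
apply/fpsP => n; rewrite (coef_ribbon_series _ _ (leqnn _)).
rewrite transfer_cat transfer_zero transfer_cat; congr fpscoef.
apply: eq_transfer (size_nseq _ _) _ => v _; exact: transfer_const_true.
Qed.

Theorem claim1p1p3 (r : nat) (hr : (0 < r)%N) (w : seq bool) :
  ribbon_series true false w r =
  ribbon_series false true (rev w) r *
    \prod_(h < r) (1 - fpsX * fpsC ('X^h : {poly int}))^-1.
Proof.
case: r hr => // r _; pose x : {fps {poly int}} := fpsX; pose y : {fps {poly int}} := fpsC 'X.
set Q := \prod_(h < r.+1) _.
have QP : Q * \prod_(h < r.+1) (1 - x * y ^+ h) = 1.
  rewrite -big_split big1 // => h _.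
  by rewrite /= -fpsC_exp mulVr //; apply: fps_unit_1BXC.
pose one := fun _ : seq bool => 1 : {fps {poly int}}.
pose f := glue y x (rev (nseq r.+1 false)).
(* This [M] leaves at least [n.+1] blocks of [r.+1] zeros after [w], enough for a factor
   [x ^+ n.+1], which is invisible in coefficient [n]. *)
apply/fpsP => n; pose M := (size w + n.+1 * r.+1)%N.
have MK : (M - size w = n.+1 * r.+1)%N by rewrite addKn.
rewrite (@coef_ribbon_series _ _ _ _ _ M) ?MK; last first.
  by rewrite leq_add2l leq_mul2r leqnSn orbT.
set K := (n.+1 * r.+1).+1; set W := _ ++ _.
have su (b : bool) : size (nseq r.+1 b) = r.+1 by rewrite size_nseq.
(* The functional [1 - Q * f] vanishes on the zero window, where [f] is the inverse of [Q]. *)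
have [z Ez] : exists z, transfer x y (fun v => 1 - Q * f v) W (nseq r.+1 true)
    = x ^+ n.+1 * z.
  rewrite /W catA transfer_cat; apply: (@transfer_dvd _ _ _ _ _ r) => // v sv.
  apply: transfer_tail sv (leqnSn _).
  by rewrite /f rev_nseq glue_zero QP subrr.
have -> : transfer x y (fun=> 1) W (nseq r.+1 true)
    = Q * transfer x y f W (nseq r.+1 true) + x ^+ n.+1 * z.
  rewrite -Ez -transfer_linear; apply: (@eq_transfer _ _ _ r) => // v _.
  by rewrite addrC subrK.
rewrite -[LHS]/(fpscoef _ n + fpscoef _ n) coef_fpsXnM // addr0 mulrC.
congr (fpscoef (_ * _) n); rewrite ribbon_series_false_true.
rewrite (transfer_adjoint _ _ _ (su false) (su true)) /W !rev_cat !rev_nseq -catA.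
(* In the reversed word the zeros come first and fix the zero window; the ones come last and
   preserve the functional [one]. *)
rewrite transfer_cat transfer_zero transfer_cat.
apply: eq_transfer (su _) _ => v sv.
transitivity (transfer x y one (nseq M true) v).
  apply: eq_transfer sv _ => u su'.
  by rewrite -[in nseq _ _]su' -size_rev glue_ones.
exact: transfer_const_true.
Qed.
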